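(* Let $X$ and $Y$ be non-empty locally compact Hausdorff spaces and let $T\colon C_0(X,\mathbb{R})\to C_0(Y,\mathbb{R})$ be a ring isomorphism in norm. Then there exist a continuous function $w\colon Y\to\{\pm1\}$ and a homeomorphism $\varphi\colon Y\to X$ such that \[ T(f)(y)=w(y)f(\varphi(y)) \] for every $f\in C_0(X,\mathbb{R})$ and $y\in Y$. Conversely, for every continuous function $w\colon Y\to\{\pm1\}$ and every homeomorphism $\varphi\colon Y\to X$, the map $T\colon C_0(X,\mathbb{R})\to C_0(Y,\mathbb{R})$ given by $T(f)(y)=w(y)f(\varphi(y))$ $(f\in C_0(X,\mathbb{R}),\ y\in Y)$ is a ring isomorphism in norm.
   Context: $C_0(X,\mathbb{R})$ is the Banach algebra of all continuous $\mathbb{R}$-valued functions on $X$ vanishing at infinity, with the supremum norm $\|\cdot\|$ and pointwise operations; similarly for $Y$. A map $T\colon C_0(X,\mathbb{R})\to C_0(Y,\mathbb{R})$ is called a ring isomorphism in norm if it is a bijection (not assumed linear, additive, multiplicative or continuous) and satisfies $\|T(f+g)\|=\|T(f)+T(g)\|$ and $\|T(fg)\|=\|T(f)T(g)\|$ for every $f,g\in C_0(X,\mathbb{R})$. *)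

(* Defs.v *)
From HB Require Import structures.
From mathcomp Require Import all_boot all_order all_algebra.
From mathcomp Require Import all_classical all_reals.
From mathcomp Require Import topology normedtype.

Set Implicit Arguments.
Unset Strict Implicit.
Unset Printing Implicit Defensive.

Import Order.TTheory GRing.Theory Num.Theory.
Import numFieldNormedType.Exports.

Local Open Scope classical_set_scope.
Local Open Scope ring_scope.

Definition vanishes_at_infinity (R : realType) (X : topologicalType)
    (f : X -> R) : Prop :=
  forall e : R, 0 < e ->
    exists2 K : set X, compact K & forall x, ~ K x -> `|f x| < e.

Definition C0_pred (R : realType) (X : topologicalType) : {pred X -> R} :=
  fun f => `[< continuous f /\ vanishes_at_infinity f >].

Record C0 (R : realType) (X : topologicalType) := MkC0 {
  C0_fun :> X -> R;
  C0_funP : C0_fun \in @C0_pred R X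
}.

HB.instance Definition _ (R : realType) (X : topologicalType) :=
  [isSub for @C0_fun R X].
HB.instance Definition _ (R : realType) (X : topologicalType) :=
  [Choice of C0 R X by <:].

Section C0_algebra.
Context {R : realType} {X : topologicalType}.
Implicit Types (f g : C0 R X) (a : R).

Lemma C0P (f : X -> R) :
  reflect (continuous f /\ vanishes_at_infinity f) (f \in @C0_pred R X).
Proof. exact: asboolP. Qed.

Lemma C0_continuous f : continuous f.
Proof. by have /C0P[] := C0_funP f. Qed.

Lemma C0_vanishes f : vanishes_at_infinity f.
Proof. by have /C0P[] := C0_funP f. Qed.

Lemma C0_bounded f : exists M : R, forall x, `|f x| <= M.
Proof.
have [K cK fK] := @C0_vanishes f 1 ltr01.
have cfK : compact (f @` K).
  exact/continuous_compact/cK/continuous_subspaceT/C0_continuous.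
have [M [_ fM]] := compact_bounded cfK.
have M1 : M < `|M| + 1 by rewrite (le_lt_trans (ler_norm M))// ltrDl ltr01.
exists (`|M| + 1) => x; have [Kx|nKx] := pselect (K x).
  exact: (fM _ M1 (f x) (imageP f Kx)).
by rewrite (le_trans (ltW (fK _ nKx)))// lerDr.
Qed.

Lemma C0_submod_closed : submod_closed (@C0_pred R X).
Proof.
split.
  apply/C0P; split; first exact: cst_continuous.
  by move=> e e0; exists set0; [exact: compact0 | move=> x _ /=; rewrite normr0].
move=> a f g /C0P[cf vf] /C0P[cg vg]; apply/C0P; split.
  move=> x; apply: (@cvgD _ R); last exact: cg.
  by apply: (@cvgM R); [exact: cvg_cst | exact: cf].
move=> e e0.
have d0 : 0 < e / 2 / (`|a| + 1).
  by rewrite divr_gt0 ?divr_gt0// ltr_wpDl.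
have [K cK fK] := vf _ d0.
have [L cL gL] := vg (e / 2) (divr_gt0 e0 (ltr0Sn R 1)).
exists (K `|` L); first exact: compactU.
move=> x /not_orP[/fK fx /gL gx] /=.
rewrite (splitr e) (le_lt_trans (ler_normD _ _))// ler_ltD//.
rewrite /GRing.scale/= normrM.
move: fx; rewrite ltr_pdivlMr ?ltr_wpDl// => fx; apply: le_trans (ltW fx).
by rewrite mulrC ler_wpM2l// lerDl.
Qed.

HB.instance Definition _ :=
  GRing.isSubmodClosed.Build R (X -> R) (@C0_pred R X) C0_submod_closed.
HB.instance Definition _ := [SubChoice_isSubLmodule of C0 R X by <:].

Lemma C0_mul_subproof f g : (fun x => f x * g x) \in @C0_pred R X.
Proof.
apply/C0P; split; first by move=> x; apply: cvgM; exact: C0_continuous.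
move=> e e0; have [M fM] := C0_bounded f.
have M0 : 0 < `|M| + 1 by rewrite ltr_wpDl.
have [K cK gK] := @C0_vanishes g (e / (`|M| + 1)) (divr_gt0 e0 M0).
exists K => // x /gK; rewrite ltr_pdivlMr// mulrC => gx.
rewrite normrM (le_lt_trans _ gx)// ler_wpM2r//.
by rewrite (le_trans (fM x))// (le_trans (ler_norm M))// lerDl.
Qed.

(* C0 has no unit unless X is compact, hence is not an instance of the
   (unital) ring structures of the library. *)
Definition C0_mul f g : C0 R X := MkC0 (C0_mul_subproof f g).

Definition C0_norm f : R := sup (range (fun x => `|f x|)).

Lemma C0_normP f x : `|f x| <= C0_norm f.
Proof.
have [M fM] := C0_bounded f.
by apply: ub_le_sup; [exists M => _ [y _ <-] | exists x].
Qed.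

Lemma C0_norm_le f (M : R) : 0 <= M -> (forall x, `|f x| <= M) ->
  C0_norm f <= M.
Proof.
move=> M0 fM; have [[x _]|X0] := pselect ([set: X] !=set0).
  by apply: ge_sup => [|_ [y _ <-]//]; exists `|f x|, x.
have XE : [set: X] = set0.
  by apply/seteqP; split=> // y _; apply: X0; exists y.
by rewrite /C0_norm XE image_set0 sup0.
Qed.

Lemma C0_norm_ge0 f : 0 <= C0_norm f.
Proof.
have [[x _]|X0] := pselect ([set: X] !=set0).
  exact: le_trans (C0_normP f x).
have XE : [set: X] = set0.
  by apply/seteqP; split=> // y _; apply: X0; exists y.
by rewrite /C0_norm XE image_set0 sup0.
Qed.

Lemma C0_normD f g : C0_norm (f + g) <= C0_norm f + C0_norm g.
Proof.
apply: C0_norm_le => [|x]; first by rewrite addr_ge0 ?C0_norm_ge0.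
by rewrite (le_trans (ler_normD _ _))// lerD ?C0_normP.
Qed.

Lemma C0_normZ_le a f : C0_norm (a *: f) <= `|a| * C0_norm f.
Proof.
apply: C0_norm_le => [|x]; first by rewrite mulr_ge0 ?C0_norm_ge0.
by rewrite [X in `|X|]/(a * f x) normrM ler_wpM2l ?C0_normP.
Qed.

Lemma C0_normZ a f : C0_norm (a *: f) = `|a| * C0_norm f.
Proof.
apply/eqP; rewrite eq_le C0_normZ_le/=.
have [->|a0] := eqVneq a 0; first by rewrite normr0 mul0r C0_norm_ge0.
rewrite -ler_pdivlMl ?normr_gt0// -normfV.
by rewrite -{1}[f](scalerK a0) C0_normZ_le.
Qed.

Lemma C0_norm0_eq0 f : C0_norm f = 0 -> f = 0.
Proof.
move=> f0; apply/val_inj/funext => x /=; apply/eqP.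
by rewrite -normr_le0 -f0 C0_normP.
Qed.

HB.instance Definition _ := Lmodule_isNormed.Build R (C0 R X)
  C0_normD C0_normZ C0_norm0_eq0.

Lemma C0_normE f : `|f| = sup (range (fun x => `|f x|)).
Proof. by []. Qed.

Lemma C0_addE f g x : (f + g) x = f x + g x.
Proof. by []. Qed.

Lemma C0_mulE f g x : C0_mul f g x = f x * g x.
Proof. by []. Qed.

End C0_algebra.

Definition ring_iso_in_norm (R : realType) (X Y : topologicalType)
    (T : C0 R X -> C0 R Y) : Prop :=
  [/\ bijective T,
      forall f g, `|T (f + g)| = `|T f + T g| &
      forall f g, `|T (C0_mul f g)| = `|C0_mul (T f) (T g)| ].

Definition homeomorphism (X Y : topologicalType) (phi : X -> Y) : Prop :=
  continuous phi /\
  exists psi : Y -> X, [/\ cancel phi psi, cancel psi phi & continuous psi].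

Definition sign_valued (R : realType) (Y : Type) (w : Y -> R) : Prop :=
  forall y, w y = 1 \/ w y = -1.

(* Main.v *)
Require Import Defs.
From mathcomp Require Import all_boot all_order all_algebra.
From mathcomp Require Import all_classical all_reals.
From mathcomp Require Import topology normedtype.
From mathcomp Require Import ring lra.
Import Order.TTheory GRing.Theory Num.Theory.
Import numFieldNormedType.Exports.
Local Open Scope classical_set_scope.
Local Open Scope ring_scope.

(** Write N(f) for the norm of T f.

    The additive hypothesis alone makes T additive.  It says that T is an
    isometry from the group C_0(X), with the translation invariant metric
    N(f - g), onto the normed space C_0(Y); hence h |-> a + b - h becomes,
    through T, an involutive isometry of C_0(Y) that swaps T a and T b, and
    such an isometry fixes the midpoint (Mazur-Ulam,
    [isometry_swap_midpoint]).  So T preserves midpoints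
    ([norm_additive_is_additive]).

    The multiplicative hypothesis then makes N a complete norm on the ring
    C_0(X) with N(f^2) = N(f)^2 and N(fg) <= N(f) N(g).  If N(f) <= 3/4, the
    equation (1 - g)^2 = 1 - f is solvable in C_0(X) by iterating
    g |-> (f + g^2) / 2, a contraction for N.  Squares being nonnegative,
    f <= 1: an order relation, and from it a bound of the sup norm by N, comes
    out of a purely algebraic identity ([norm_le_double_image]).  Thus S, the
    inverse of T, is a bounded additive map, so it is linear.

    Both T and S preserve disjointness: if fg = 0 then N(fg) = 0.  A bounded
    disjointness preserving functional on C_0 is a multiple of a point
    evaluation ([disjointness_preserving_functional]), so
    S p (x) = c(x) p(psi(x)) ([inverse_weighted_composition]).  This formula
    shows T(fg) o psi = f * (T g o psi), whence N(fg) <= |f| N(g); applied to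
    the powers f^(2^k) and combined with N(f^2) = N(f)^2 it yields
    N(f) <= |f| ([image_norm_le]), while the powers also turn |f| <= 2 N(f)
    into |f| <= N(f) ([norm_le_image]).  Now T is bounded too and has the form
    T f (y) = w(y) f(phi(y)) ([forward_weighted_composition]).

    Urysohn functions finish the argument: they force phi and psi to be inverse
    to each other with c(x) w(psi(x)) = 1, they bound |w| and |c| by 1 because T
    and S are contractions, hence |w| = 1, and they give the continuity of phi,
    psi and w. *)

(** * Isometries and midpoints *)

Lemma half_scaleD (R : realType) (V : normedModType R) (v : V) :
  2^-1 *: v + 2^-1 *: v = v.
Proof.
by rewrite -scalerDl -[RHS]scale1r; congr (_ *: _); field.
Qed.

(** Vaisala's proof: r is the point reflection in the midpoint z of p and q.
    If g is a bijective isometry fixing p and q, so is r g^-1 r g, and it moves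
    z twice as far as g does.  As every such isometry moves z by at most
    2 |p - z|, iterating the construction leaves no room for a displacement. *)
Lemma isometry_fixes_midpoint (R : realType) (V : normedModType R) (p q : V)
    (g h : V -> V) :
  cancel g h -> cancel h g -> (forall x y, `|g x - g y| = `|x - y|) ->
  g p = p -> g q = q -> g (2^-1 *: (p + q)) = 2^-1 *: (p + q).
Proof.
set z := 2^-1 *: (p + q) => gK hK gi gp gq.
pose r x := p + q - x.
have rK : involutive r by move=> x; rewrite /r opprB addrC subrK.
have ri x y : `|r x - r y| = `|x - y|.
  by rewrite /r opprB addrC addrA subrK distrC.
have pqE : p + q = z + z by rewrite /z half_scaleD.
have rz : r z = z by rewrite /r pqE addrK.
have rp : r p = q by rewrite /r addrC addKr.
have rq : r q = p by rewrite /r addrK.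
have rr x : `|r x - x| = 2 * `|x - z|.
  rewrite -[2]ger0_norm// -normrZ -[RHS]normrN; congr (`|_|).
  by rewrite scaler_nat mulr2n opprD opprB /r pqE [RHS]addrACA addrA.
(* r \o h \o r \o g has the same properties as g and displaces z twice as
   far. *)
have H n : forall g h : V -> V,
  cancel g h -> cancel h g -> (forall x y, `|g x - g y| = `|x - y|) ->
  g p = p -> g q = q -> 2 ^+ n * `|g z - z| <= 2 * `|p - z|.
  elim: n => [|n IH] {gK hK gi gp gq}g {}h gK hK gi gp gq.
    rewrite expr0 mul1r mulr_natl mulr2n -{1}(subrK (g p) (g z)) -addrA.
    by rewrite (le_trans (ler_normD _ _))// gi gp distrC.
  have hi x y : `|h x - h y| = `|x - y| by rewrite -gi !hK.
  have hp : h p = p by rewrite -{1}gp gK.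
  have hq : h q = q by rewrite -{1}gq gK.
  have := IH (fun x => r (h (r (g x)))) (fun x => h (r (g (r x)))).
  rewrite /= gp gq rp rq hp hq rp rq => /(_ _ _ _ erefl erefl).
  have -> : `|r (h (r (g z))) - z| = 2 * `|g z - z|.
    by rewrite -{2}rz ri -{2}(gK z) hi rr.
  rewrite exprSr -mulrA; apply => x.
  - by rewrite rK hK rK gK.
  - by rewrite hK rK gK rK.
  - by move=> y; rewrite ri hi ri gi.
apply/eqP; rewrite -subr_eq0 -normr_le0 leNgt; apply/negP => d0.
have [n] : exists n, 2 * `|p - z| / `|g z - z| < n%:R.
  exists (Num.bound (2 * `|p - z| / `|g z - z|)).
  by rewrite archi_boundP// divr_ge0// mulr_ge0.
rewrite ltr_pdivrMr// ltNge => /negP; apply.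
rewrite (le_trans _ (H n g h _ _ _ _ _))// ler_wpM2r// -natrX ler_nat.
exact/ltnW/ltn_expl.
Qed.

(** Composing with the point reflection in the midpoint reduces to an isometry
    that fixes both points. *)
Lemma isometry_swap_midpoint (R : realType) (V : normedModType R) (p q : V)
    (g : V -> V) :
  involutive g -> (forall x y, `|g x - g y| = `|x - y|) ->
  g p = q -> g (2^-1 *: (p + q)) = 2^-1 *: (p + q).
Proof.
move=> gK gi gp.
have gq : g q = p by rewrite -gp gK.
pose r x := p + q - x.
have rK : involutive r by move=> x; rewrite /r opprB addrC subrK.
set m := 2^-1 *: (p + q).
have rm : r m = m by rewrite /r -{1}[p + q]half_scaleD addrK.
suff H : r (g m) = m by rewrite -[g m]rK H.
apply: (@isometry_fixes_midpoint _ _ p q (r \o g) (g \o r)) => [x|x|x y||] /=.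
- by rewrite rK gK.
- by rewrite gK rK.
- by rewrite /r opprB addrC addrA subrK distrC gi.
- by rewrite gp /r addrK.
- by rewrite gq /r addrC addKr.
Qed.

(** Nothing relates T to the norm of its domain, so Mazur-Ulam is applied in the
    codomain only, to the conjugate by T of h |-> f + g - h. *)
Lemma norm_additive_is_additive (R : realType) (U V : normedModType R)
    (T : U -> V) (S : V -> U) :
  cancel T S -> cancel S T -> (forall f g, `|T (f + g)| = `|T f + T g|) ->
  forall f g, T (f + g) = T f + T g.
Proof.
move=> TK SK TD.
have T0 : T 0 = 0.
  apply/eqP; rewrite -normr_eq0; apply/eqP.
  have := TD 0 0; rewrite addr0 -mulr2n -scaler_nat normrZ ger0_norm//; lra.
have TN f : T (- f) = - T f.
  apply/eqP; rewrite -addr_eq0 -normr_eq0; apply/eqP.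
  by rewrite -TD addNr T0 normr0.
have TB f g : `|T (f - g)| = `|T f - T g| by rewrite TD TN.
have TM f g : T (2^-1 *: (f + g)) = 2^-1 *: (T f + T g).
  set m := 2^-1 *: (T f + T g).
  have : T (f + g - S m) = m.
    apply: (@isometry_swap_midpoint _ _ _ _ (fun x => T (f + g - S x)))
      => [x|x y|].
    - by rewrite TK opprB addrC subrK SK.
    - by rewrite -TB opprB addrC addrA subrK TB !SK distrC.
    - by rewrite TK addrC addKr.
  move=> /(congr1 S); rewrite TK => H.
  rewrite -[m]SK; congr T; apply: (@scalerI _ _ 2); first by rewrite pnatr_eq0.
  by rewrite scalerA divff ?pnatr_eq0// scale1r scaler_nat mulr2n -{1}H subrK.
move=> f g; have := TM (f + g) 0; rewrite addr0 T0 addr0 TM.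
move/(congr1 (fun v => 2 *: v)).
by rewrite !scalerA divff ?pnatr_eq0// !scale1r.
Qed.

(** * Functions vanishing at infinity *)

Section C0_toolkit.
Context {R : realType} {X : topologicalType}.
Implicit Types f g h u s : C0 R X.

Lemma C0_ext f g : (forall x, f x = g x) -> f = g.
Proof. by move=> fg; apply/val_inj/funext. Qed.

Lemma C0_oppE f x : (- f) x = - f x.
Proof. by []. Qed.

Lemma C0_scaleE a f x : (a *: f) x = a * f x.
Proof. by []. Qed.

Lemma C0_eval0 x : (0 : C0 R X) x = 0.
Proof. by []. Qed.

Lemma C0_norm_ge f x : `|f x| <= `|f|.
Proof. exact: C0_normP. Qed.

Lemma C0_norm_leP f (M : R) : 0 <= M -> (forall x, `|f x| <= M) -> `|f| <= M.
Proof. exact: C0_norm_le. Qed.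

Lemma C0_normM f g : `|C0_mul f g| <= `|f| * `|g|.
Proof.
apply: C0_norm_leP => [|x]; first by rewrite mulr_ge0.
by rewrite C0_mulE normrM ler_pM ?C0_norm_ge.
Qed.

Lemma C0_norm_sqr f : `|C0_mul f f| = `|f| ^+ 2.
Proof.
apply/eqP; rewrite eq_le expr2 C0_normM/=.
rewrite -ler_sqrt ?normr_ge0// -expr2 sqrtr_sqr normr_id.
apply: C0_norm_leP; first by rewrite sqrtr_ge0.
move=> x; rewrite -[leLHS]normr_id -sqrtr_sqr ler_sqrt ?normr_ge0//.
by rewrite expr2 -normrM -C0_mulE C0_norm_ge.
Qed.

Lemma C0_norm_eq (Y : topologicalType) f (g : C0 R Y) :
  (forall x, exists y, `|f x| = `|g y|) ->
  (forall y, exists x, `|f x| = `|g y|) -> `|f| = `|g|.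
Proof.
move=> fg gf; apply/eqP; rewrite eq_le; apply/andP; split.
  by apply: C0_norm_le => // x; have [y ->] := fg x; exact: C0_normP.
by apply: C0_norm_le => // y; have [x <-] := gf y; exact: C0_normP.
Qed.

(** Every function built below by truncation or division is recognised as an
    element of C_0 by comparing it with a known one. *)
Lemma C0_dominated f (k : X -> R) : continuous k ->
  (forall x, `|k x| <= `|f x|) -> exists g : C0 R X, forall x, g x = k x.
Proof.
move=> ck kf.
suff kP : k \in @C0_pred R X by exists (MkC0 kP).
apply/C0P; split=> // e e0; have [K cK fK] := C0_vanishes f e0.
by exists K => // x /fK; apply: le_lt_trans.
Qed.

(** Density of the functions that vanish near the zeros of f, with an explicit
    approximant. *)
Lemma soft_threshold f (e : R) : 0 <= e -> exists g, forall x,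
  (`|f x| <= e -> g x = 0) /\ `|f x - g x| <= e.
Proof.
move=> e0; pose k x := f x - Num.max (Num.min (f x) e) (- e).
have [||g gE] := @C0_dominated f k.
- move=> x; apply: continuousB; first exact: C0_continuous.
  apply: continuous_max; last exact: cst_continuous.
  by apply: continuous_min; [exact: C0_continuous | exact: cst_continuous].
- move=> x; rewrite /k.
  have [f0|f0] := ger0P (f x); rewrite ler_norml;
    by case: (lerP (f x) e) => ?;
    [case: (lerP (f x) (- e))|case: (lerP e (- e))] => ?; lra.
exists g => x; rewrite gE /k; split.
  by rewrite ler_norml; case: (lerP (f x) e) => ?;
    [case: (lerP (f x) (- e))|case: (lerP e (- e))] => ?; lra.
by rewrite ler_norml; case: (lerP (f x) e) => ?;
    [case: (lerP (f x) (- e))|case: (lerP e (- e))] => ?; lra.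
Qed.

(** The companion of [soft_threshold]: this function is supported where the
    thresholded f vanishes, so the product of the two is zero, and for
    d > 0 it is nonzero at a zero of f at which u does not vanish. *)
Lemma bump_near_zeros f u (d : R) : 0 <= d ->
  exists g, forall x, g x = u x * Num.max 0 (d - `|f x|).
Proof.
move=> d0; apply: (@C0_dominated (d *: u)).
  move=> x; apply: continuousM; first exact: C0_continuous.
  apply: continuous_max; first exact: cst_continuous.
  apply: continuousB; first exact: cst_continuous.
  by apply: cvg_norm; exact: C0_continuous.
move=> x; rewrite C0_scaleE !normrM mulrC ler_wpM2r// (ger0_norm d0).
rewrite ger0_norm ?le_max ?lexx//; by rewrite ge_max d0/= gerBl.
Qed.

(** A pointwise inequality |f| <= M |g| becomes the vanishing of one element of
    C_0, to which injectivity of an operator can be applied. *)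
Lemma excess f g (M : R) : 0 <= M ->
  exists h, forall x, h x = Num.max 0 (`|f x| - M * `|g x|).
Proof.
move=> M0; apply: (@C0_dominated f).
  move=> x.
  apply: (@continuous_max _ _ (fun=> 0) (fun x => `|f x| - M * `|g x|)).
    exact: cst_continuous.
  apply: continuousB; first by apply: cvg_norm; exact: C0_continuous.
  apply: continuousM; first exact: cst_continuous.
  by apply: cvg_norm; exact: C0_continuous.
move=> x; rewrite ger0_norm ?le_max ?lexx// ge_max normr_ge0/= gerBl.
by rewrite mulr_ge0.
Qed.

Lemma divide_by_max1 f s :
  exists g, forall x, g x = f x / Num.max 1 (s x).
Proof.
have s1 x : 1 <= Num.max 1 (s x) by rewrite le_max lexx.
apply: (@C0_dominated f).
  move=> x; apply: continuousM; first exact: C0_continuous.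
  apply: continuousV; first by rewrite gt_eqF// (lt_le_trans ltr01).
  by apply: continuous_max; [exact: cst_continuous|exact: C0_continuous].
move=> x; have s0 : 0 < Num.max 1 (s x) by exact: lt_le_trans (s1 x).
by rewrite normrM normfV (gtr0_norm s0) ler_piMr// invf_le1.
Qed.

(** The limit is the pointwise supremum of u_n - 2C / 2^n: these functions
    increase with n while u_n + 2C / 2^n decrease, and the two families stay on
    either side of it. *)
Lemma C0_complete (u : nat -> C0 R X) (C : R) :
  (forall n, `|u n.+1 - u n| <= C / 2 ^+ n) ->
  exists l, forall n, `|l - u n| <= 2 * C / 2 ^+ n.
Proof.
move=> uC.
have Cge0 : 0 <= C by have := uC 0; rewrite expr0 divr1; exact: le_trans.
pose b x n := u n x - 2 * C / 2 ^+ n.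
pose c x n := u n x + 2 * C / 2 ^+ n.
have ux x n : `|u n.+1 x - u n x| <= C / 2 ^+ n.
  by rewrite (le_trans _ (uC n))// -C0_oppE -C0_addE C0_norm_ge.
have pn n : C / 2 ^+ n = 2 * (C / 2 ^+ n.+1).
  by rewrite exprS invfM mulrCA (mulVKf (lt0r_neq0 (ltr0Sn R 1))).
have bS x n : b x n <= b x n.+1.
  by have := ux x n; rewrite ler_norml /b -!mulrA (pn n); lra.
have cS x n : c x n.+1 <= c x n.
  by have := ux x n; rewrite ler_norml /c -!mulrA (pn n); lra.
have bc x n m : b x n <= c x m.
  have bm : {homo b x : i j / (i <= j)%N >-> i <= j}.
    by apply: homo_leq => //; exact: le_trans.
  have cm : {homo c x : i j / (i <= j)%N >-> j <= i}.
    by apply: homo_leq => // j i k ji kj; exact: le_trans ji.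
  apply: (le_trans (bm _ _ (leq_maxl n m))).
  apply: (le_trans _ (cm _ _ (leq_maxr n m))).
  have d0 : 0 <= 2 * C / 2 ^+ maxn n m.
    by rewrite !mulr_ge0// invr_ge0 exprn_ge0.
  by rewrite /b /c; lra.
pose l x := sup (range (b x)).
have lu x n : `|l x - u n x| <= 2 * C / 2 ^+ n.
  have : b x n <= l x.
    by apply: ub_le_sup; [exists (c x 0%N) => _ [m _ <-] | exists n].
  have : l x <= c x n.
    by apply: ge_sup; [exists (b x 0%N), 0%N|move=> _ [m _ <-]].
  by rewrite /b /c ler_norml; lra.
have small e : 0 < e -> exists n, 2 * C / 2 ^+ n < e.
  move=> e0; exists (Num.bound (2 * C / e)).
  rewrite ltr_pdivrMr ?exprn_gt0// [ltRHS]mulrC -ltr_pdivrMr//.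
  exact: upper_nthrootP.
have lP : l \in @C0_pred R X.
  apply/C0P; split.
    move=> x; apply/cvgrPdist_lt => e e0.
    have [n ne] := small (e / 3) (divr_gt0 e0 (ltr0Sn _ _)).
    have /cvgr_dist_lt/(_ (e / 3)) := @C0_continuous _ _ (u n) x.
    move=> /(_ (divr_gt0 e0 (ltr0Sn _ _))).
    apply: filterS => y uy.
    have := lu x n; have := lu y n; move: uy ne.
    by rewrite ltr_norml !ler_norml ltr_norml; lra.
  move=> e e0; have [n ne] := small (e / 2) (divr_gt0 e0 (ltr0Sn _ _)).
  have [K cK uK] := @C0_vanishes _ _ (u n) (e / 2) (divr_gt0 e0 (ltr0Sn _ _)).
  exists K => // x /uK; have := lu x n; move: ne.
  by rewrite !ltr_norml ler_norml; lra.
exists (MkC0 lP) => n; apply: C0_norm_leP.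
  by rewrite !mulr_ge0// invr_ge0 exprn_ge0.
by move=> x; exact: lu.
Qed.

End C0_toolkit.

(** * Disjointness preserving functionals *)

(** The defect b t = a t - t a(1) is additive, vanishes at the integers, and is
    bounded on the unit interval, hence bounded everywhere; since b (n t) is
    n (b t), it is zero. *)
Lemma bounded_additive_linear (R : realType) (a : R -> R) (M : R) :
  (forall s t, a (s + t) = a s + a t) -> (forall t, `|a t| <= M * `|t|) ->
  forall t, a t = t * a 1.
Proof.
move=> aD aM t; pose b s := a s - s * a 1.
have bD s r : b (s + r) = b s + b r by rewrite /b aD; ring.
have b1 : b 1 = 0 by rewrite /b mul1r subrr.
have b0 : b 0 = 0 by have := bD 0 0; rewrite addr0; lra.
have bN s : b (- s) = - b s by have := bD (- s) s; rewrite addNr b0; lra.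
have bMn s n : b (s *+ n) = b s *+ n.
  by elim: n => [|n IH]; rewrite ?mulr0n// !mulrS bD IH.
have bz (z : int) : b z%:~R = 0.
  by case: z => n; rewrite ?NegzE ?mulrNz ?bN -pmulrn bMn b1 mul0rn ?oppr0.
have bM s : `|b s| <= (M + `|a 1|) * `|s|.
  rewrite (le_trans (ler_normB _ _))// mulrDl lerD// normrM mulrC//.
have M0 : 0 <= M + `|a 1|.
  by have := bM 1; rewrite normr1 mulr1; exact: le_trans.
have bn n : `|b t| *+ n <= M + `|a 1|.
  rewrite -normrMn -bMn; set s := t *+ n.
  have -> : b s = b (s - (Num.floor s)%:~R) by rewrite bD bN bz subr0.
  rewrite (le_trans (bM _))// ler_piMr// ger0_norm ?subr_ge0 ?floor_le_tmp//.
  have := floorD1_gt s; rewrite intrD; lra.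
suff bt0 : b t = 0 by move: bt0; rewrite /b; lra.
apply/eqP; rewrite -normr_le0 leNgt; apply/negP => bt.
have := bn (Num.bound ((M + `|a 1|) / `|b t|)).
apply/negP; rewrite -ltNge -mulr_natr mulrC -ltr_pdivrMr//.
by rewrite archi_boundP// divr_ge0.
Qed.

Section Functional.
Context {R : realType} {Y : topologicalType}.
Context (L : C0 R Y -> R) (C : R).
Context (LD : forall f g, L (f + g) = L f + L g).
Context (LC : forall f, `|L f| <= C * `|f|).

Lemma bounded_additive_homogeneous a f : L (a *: f) = a * L f.
Proof.
rewrite -{2}[f]scale1r.
apply: (@bounded_additive_linear _ (fun a => L (a *: f)) (C * `|f|)) => s.
  by move=> t; rewrite scalerDl LD.
by rewrite mulrAC -mulrA -normrZ.
Qed.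

Context (Ldisj : forall f g, C0_mul f g = 0 -> L f = 0 \/ L g = 0).

Let L0 : L 0 = 0.
Proof. by rewrite -(scale0r 0) bounded_additive_homogeneous mul0r. Qed.

Let LB f g : L (f - g) = L f - L g.
Proof. by rewrite LD -scaleN1r bounded_additive_homogeneous mulN1r. Qed.

Let C_ge0 u : L u != 0 -> 0 < C.
Proof.
move=> Lu; have := LC u; rewrite -normr_gt0 in Lu.
move=> /(lt_le_trans Lu); rewrite ltNge => h; rewrite ltNge; apply: contra h.
by move=> C0; rewrite mulr_le0_ge0.
Qed.

Let ideal (s : C0 R Y) := forall k, L (C0_mul s k) = 0.

Let idealD s t : ideal s -> ideal t -> ideal (s + t).
Proof.
move=> Is It k.
rewrite (_ : C0_mul _ _ = C0_mul s k + C0_mul t k) ?LD ?Is ?It ?addr0//.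
by apply: C0_ext => y; rewrite C0_addE !C0_mulE C0_addE; ring.
Qed.

Let idealM s t : ideal s -> ideal (C0_mul s t).
Proof.
move=> Is k; rewrite -(Is (C0_mul t k)); congr L.
by apply: C0_ext => y; rewrite !C0_mulE; ring.
Qed.

Let idealZ a s : ideal s -> ideal (a *: s).
Proof.
move=> Is k; rewrite -(mulr0 a) -(Is k) -bounded_additive_homogeneous; congr L.
by apply: C0_ext => y; rewrite C0_scaleE !C0_mulE C0_scaleE; ring.
Qed.

(** The functions s all of whose multiples are killed by L form an ideal, and it
    has a common zero outside those of u.  Otherwise, by compactness of
    {|u| >= e}, the ideal contains some s >= 0 with s > 1 there; then u
    thresholded at e is a multiple of s, so L kills it, although it is too close
    to u for that. *)
Let common_zero u : L u != 0 ->
  exists2 y, u y != 0 & forall s, ideal s -> s y = 0.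
Proof.
move=> Lu; have Cp := C_ge0 _ Lu.
have [e e0 Ce] : exists2 e, 0 < e & C * e < `|L u|.
  exists (`|L u| / 2 / C); first by rewrite !divr_gt0// normr_gt0.
  by rewrite mulrC divfK ?gt_eqF// ltr_pdivrMr// ltr_pMr ?normr_gt0// ltr1n.
have [ue ueP] := soft_threshold u e (ltW e0).
have Lue : L ue != 0.
  apply/eqP => Lue; have := LC (u - ue); rewrite LB Lue subr0 leNgt.
  move/negP; apply; apply: le_lt_trans Ce; rewrite ler_pM2l//.
  by apply: C0_norm_leP (ltW e0) _ => y; exact: (ueP y).2.
have [K cK uK] := C0_vanishes u e0.
pose D := [set s : C0 R Y | ideal s /\ forall y, 0 <= s y].
(* The bound 1 on s makes these sets a filter base: the one of s + t lies in
   those of s and t, as s and t are nonnegative. *)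
pose Z (s : C0 R Y) := [set y | e <= `|u y| /\ s y <= 1].
have D0 : D 0.
  split=> [k|y]; last by rewrite C0_eval0.
  by rewrite -L0; congr L; apply: C0_ext => y; rewrite C0_mulE C0_eval0 mul0r.
have FZ : Filter (filter_from D Z).
  apply: filter_from_filter; first by exists 0.
  move=> s t [Is s0] [It t0]; exists (s + t).
    by split; [exact: idealD | move=> y; rewrite C0_addE addr_ge0].
  move=> y [uy]; rewrite C0_addE => st; have := s0 y; have := t0 y.
  by split; split=> //; lra.
have PZ : ProperFilter (filter_from D Z).
  apply: filter_from_proper => // s [Is s0]; apply: contrapT => Z0.
  have [k kE] := divide_by_max1 ue s.
  move/eqP: Lue; apply; rewrite -(Is k); congr L; apply: C0_ext => y.
  rewrite C0_mulE kE; have [uy|uy] := lerP (`|u y|) e.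
    by rewrite (ueP y).1// mul0r mulr0.
  have sy : 1 < s y.
    rewrite ltNge; apply/negP => sy; apply: Z0; exists y; split=> //.
    exact: ltW.
  rewrite (max_idPr (ltW sy)) mulrC divfK// gt_eqF//.
  exact: lt_trans sy.
have FK : filter_from D Z K.
  exists 0 => // y [uy _]; apply: contrapT => /uK.
  by rewrite ltNge uy.
have [y [_ yZ]] := cK _ PZ FK.
have clZ s : D s -> Z s y.
  move=> Ds; have clu : closed [set y | e <= `|u y|].
    apply: (@closed_comp _ _ (fun y => `|u y|) [set t | e <= t]).
      by move=> z _; apply: cvg_norm; exact: C0_continuous.
    exact: closed_ge.
  have cls : closed [set y | s y <= 1].
    apply: (@closed_comp _ _ s [set t | t <= 1]); last exact: closed_le.
    by move=> z _; exact: C0_continuous.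
  have FZs : filter_from D Z (Z s) by exists s.
  by split; [apply: clu|apply: cls] => B By;
    have [z [[uz sz] Bz]] := yZ (Z s) B FZs By; exists z.
exists y.
  have [+ _] := clZ 0 D0; move=> uy; rewrite -normr_gt0; exact: lt_le_trans uy.
move=> s Is; apply/eqP; rewrite -sqrf_eq0 eq_le sqr_ge0 andbT leNgt.
apply/negP => s2.
(* The ideal is stable under scaling, so s ^ 2 <= 1 at y can be violated. *)
have [|_] := clZ ((2 / s y ^+ 2) *: C0_mul s s).
  split; first by apply: idealZ; exact: idealM.
  by move=> z; rewrite C0_scaleE C0_mulE -expr2 mulr_ge0 ?divr_ge0 ?sqr_ge0.
apply/negP; rewrite -ltNge C0_scaleE C0_mulE -expr2 divfK ?gt_eqF//.
by rewrite ltr1n.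
Qed.

(** L is carried by the common zero y of [common_zero].  If f y = 0, then f is
    uniformly close to a function disjoint from some bump g that is nonzero at
    y; as g lies outside the ideal, L does not kill all multiples of g, and
    disjointness forces L to kill the approximant.  So the kernel of L contains
    that of the evaluation at y. *)
Lemma disjointness_preserving_functional u : L u != 0 ->
  exists y, exists2 c, c != 0 & forall f : C0 R Y, L f = c * f y.
Proof.
move=> Lu; have [y uy Iy] := common_zero _ Lu.
have Lker (f : C0 R Y) : f y = 0 -> L f = 0.
  move=> fy; apply/eqP; rewrite -normr_le0; apply/ler_addgt0Pr => d d0.
  rewrite add0r; have Cp := C_ge0 _ Lu.
  have dC : 0 < d / C by rewrite divr_gt0.
  have [fd fdP] := soft_threshold f _ (ltW dC).
  have [g gE] := bump_near_zeros f u _ (ltW dC).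
  have [k /eqP Lgk] : exists k, L (C0_mul g k) <> 0.
    apply: contrapT => /forallNP Ng.
    have /Iy : ideal g by move=> k; apply: contrapT; exact: Ng.
    rewrite gE fy normr0 subr0 (max_idPr (ltW dC)) => /eqP.
    by rewrite mulf_eq0 (negPf uy) gt_eqF.
  have [|Lfd|] := Ldisj fd (C0_mul g k).
  - apply: C0_ext => z; rewrite !C0_mulE C0_eval0 gE.
    have [fz|fz] := lerP (`|f z|) (d / C); first by rewrite (fdP z).1// mul0r.
    rewrite (max_idPl _) ?mulr0 ?mul0r ?mulr0//.
    by rewrite subr_le0 ltW.
  - have := LC (f - fd); rewrite LB Lfd subr0 => /le_trans; apply.
    rewrite mulrC -ler_pdivlMr//; apply: C0_norm_leP (ltW dC) _ => z.
    exact: (fdP z).2.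
  - by move=> /eqP; rewrite (negPf Lgk).
exists y; exists (L u / u y); first by rewrite mulf_neq0// invr_eq0.
move=> f; have /Lker : (f - (f y / u y) *: u) y = 0.
  by rewrite C0_addE C0_oppE C0_scaleE divfK// subrr.
rewrite LB bounded_additive_homogeneous => /eqP; rewrite subr_eq0 => /eqP ->.
by rewrite mulrC mulrAC mulrA.
Qed.

End Functional.

(** * Urysohn functions and weighted composition operators *)

Lemma C0_urysohn {R : realType} {X : topologicalType} :
  hausdorff_space X -> locally_compact [set: X] ->
  forall {x : X} {U : set X}, nbhs x U ->
  exists f : C0 R X, [/\ f x = 1, forall z, 0 <= f z <= 1 &
                         forall z, ~ U z -> f z = 0].
Proof.
(* Separating x from the complement of a compact neighbourhood K, and not only
   of U, makes the function vanish off K and so at infinity. *)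
move=> hX lX x U Ux.
have [K xK [cK clK]] := lX x I.
have {}xK : nbhs x K by move: xK; rewrite /within/=; apply: filterS => y; exact.
have nV : nbhs x (U `&` K) by exact: filterI.
have [|f [cf f01 fx fV]] :=
    (@uniform_separatorP X R [set x] (~` (U `&` K)°)).1.
  apply: (locally_compact_completely_regular (R := R) lX hX).
    by apply: open_closedC; exact: open_interior.
  by move/(_ nV).
have nfV z : ~ (U `&` K) z -> 1 - f z = 0.
  move=> nUK; apply/eqP; rewrite subr_eq0 eq_sym; apply/eqP; apply: fV.
  by exists z => //; apply: contra_not nUK => /interior_subset.
have gP : (fun z => 1 - f z) \in @C0_pred R X.
  apply/C0P; split.
    by move=> z; apply: continuousB; [exact: cst_continuous | exact: cf].
  move=> e e0; exists K => // z nKz.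
  by rewrite nfV ?normr0// => -[].
exists (MkC0 gP); split=> /= [|z|z nUz].
- by rewrite (fx (f x)) ?subr0//; exists x.
- have /f01 : range f (f z) by exists z.
  by rewrite /= in_itv/=; lra.
- by apply: nfV => -[].
Qed.

(** Disjointness of S f and S g, read at a point x, says that the functional
    f |-> S f x preserves disjointness. *)
Lemma weighted_composition (R : realType) (X Y : topologicalType)
    (S : C0 R Y -> C0 R X) (C : R) :
  (forall f g, S (f + g) = S f + S g) -> (forall f, `|S f| <= C * `|f|) ->
  (forall f g, C0_mul f g = 0 -> C0_mul (S f) (S g) = 0) ->
  (forall x, exists f, S f x != 0) ->
  exists (c : X -> R) (psi : X -> Y),
    (forall x, c x != 0) /\ forall f x, S f x = c x * f (psi x).
Proof.
move=> SD SC Sdisj Snz.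
have /choice[p pP] : forall x, exists p : Y * R,
    p.2 != 0 /\ forall f, S f x = p.2 * f p.1.
  move=> x; have [u Su] := Snz x.
  have LD f g : S (f + g) x = S f x + S g x by rewrite SD C0_addE.
  have LC f : `|S f x| <= C * `|f| by rewrite (le_trans (C0_norm_ge _ _)).
  have Ldisj f g : C0_mul f g = 0 -> S f x = 0 \/ S g x = 0.
    move=> /Sdisj/(congr1 (fun h : C0 R X => h x)).
    by rewrite C0_mulE => /eqP; rewrite mulf_eq0 => /orP[]/eqP; [left|right].
  have [y [c c0 cP]] := disjointness_preserving_functional _ _ LD LC Ldisj u Su.
  by exists (y, c).
exists (fun x => (p x).2), (fun x => (p x).1).
by split=> [x|f x]; have [] := pP x.
Qed.

Lemma bernoulli_ineq (R : realType) (r : R) n :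
  1 <= r -> n%:R * (r - 1) <= r ^+ n.
Proof.
move=> r1; have r0 : 0 <= r by exact: le_trans r1.
elim: n => [|n IH]; first by rewrite mul0r.
have : 1 <= r ^+ n by rewrite exprn_ege1.
by rewrite exprS -natr1; nra.
Qed.

(** Constants disappear when inequalities between arbitrarily large powers are
    compared. *)
Lemma le_of_power_bounds (R : realType) (a b p q : R) : 0 < a -> 0 <= q ->
  (forall k : nat, a * p ^+ (2 ^ k) <= b * q ^+ (2 ^ k)) -> p <= q.
Proof.
move=> a0; rewrite le_eqVlt => /predU1P[<-|q0] H.
  have := H 0%N; rewrite expn0 !expr1 mulr0; by rewrite pmulr_rle0.
rewrite leNgt; apply/negP => qp.
have r1 : 1 < p / q by rewrite ltr_pdivlMr// mul1r.
have Hr k : (2 ^ k)%:R * (p / q - 1) <= b / a.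
  apply: (le_trans (bernoulli_ineq _ _ _ (ltW r1))).
  rewrite expr_div_n ler_pdivlMr// mulrAC ler_pdivrMr ?exprn_gt0//.
  by rewrite mulrC H.
have b0 : 0 <= b / a.
  by apply: le_trans (Hr 0%N); rewrite mulr_ge0// subr_ge0 ltW.
have r0 : 0 < p / q - 1 by rewrite subr_gt0.
have := Hr (Num.bound (b / a / (p / q - 1))).
apply/negP; rewrite -ltNge -ltr_pdivrMr// natrX.
by apply: upper_nthrootP.
Qed.

(** * Boundedness of ring isomorphisms in norm *)

Section RingIsoInNorm.
Context {R : realType} {X Y : topologicalType}.
Context (T : C0 R X -> C0 R Y) (S : C0 R Y -> C0 R X).
Implicit Types (f g : C0 R X) (p q : C0 R Y).
Context (TK : cancel T S) (SK : cancel S T).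
Context (TD : forall f g, T (f + g) = T f + T g).
Context (TM : forall f g, `|T (C0_mul f g)| = `|C0_mul (T f) (T g)|).

Let T0 : T 0 = 0.
Proof. by apply: (addrI (T 0)); rewrite -TD !addr0. Qed.

Let TN f : T (- f) = - T f.
Proof. by apply/eqP; rewrite -addr_eq0 -TD addNr T0. Qed.

Let TB f g : T (f - g) = T f - T g.
Proof. by rewrite TD TN. Qed.

Let TZn n f : T (n%:R *: f) = n%:R *: T f.
Proof.
rewrite !scaler_nat; elim: n => [|n IH]; first by rewrite !mulr0n T0.
by rewrite !mulrS TD IH.
Qed.

Let TZq m n f : T ((m%:R / n.+1%:R) *: f) = (m%:R / n.+1%:R) *: T f.
Proof.
have n0 : n.+1%:R != 0 :> R by rewrite pnatr_eq0.
apply: (scalerI n0); rewrite -TZn !scalerA mulrCA divff// mulr1.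
exact: TZn.
Qed.

Let Thalf f : T (2^-1 *: f) = 2^-1 *: T f.
Proof. by have := TZq 1 1 f; rewrite mul1r. Qed.

Let T_normM f g : `|T (C0_mul f g)| <= `|T f| * `|T g|.
Proof. by rewrite TM C0_normM. Qed.

Let T_norm_sqr f : `|T (C0_mul f f)| = `|T f| ^+ 2.
Proof. by rewrite TM C0_norm_sqr. Qed.

(** Picard iteration for 2 g = f + g^2, that is (1 - g)^2 = 1 - f; this form
    avoids a unit, which C_0 need not have. *)
Let sqrt_iter f : nat -> C0 R X :=
  fix v n := if n is n'.+1 then 2^-1 *: (f + C0_mul (v n') (v n')) else 0.

Let sqrt_iterS f n : sqrt_iter f n.+1 =
  2^-1 *: (f + C0_mul (sqrt_iter f n) (sqrt_iter f n)).
Proof. by []. Qed.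

(** For the norm |T g|, the ball of radius 1/2 is stable under
    g |-> (f + g^2) / 2 because (3/4 + 1/4) / 2 = 1/2; on it the map contracts
    by the factor 1/2. *)
Let sqrt_iter_le f n : `|T f| <= 3 / 4 -> `|T (sqrt_iter f n)| <= 2^-1.
Proof.
move=> Tf; elim: n => [|n IH]; first by rewrite T0 normr0 invr_ge0.
rewrite sqrt_iterS Thalf normrZ ger0_norm ?invr_ge0// TD.
rewrite -[leRHS]mulr1 ler_pM2l ?invr_gt0//.
rewrite (le_trans (ler_normD _ _))// T_norm_sqr.
have : `|T (sqrt_iter f n)| ^+ 2 <= 2^-1 ^+ 2.
  by rewrite lerXn2r ?nnegrE// invr_ge0.
have -> : (2^-1 : R) ^+ 2 = 1 / 4 by field.
by move: Tf; lra.
Qed.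

Let sqr_sub_le f g : `|T (C0_mul f f - C0_mul g g)| <=
  `|T f - T g| * (`|T f| + `|T g|).
Proof.
have -> : C0_mul f f - C0_mul g g = C0_mul (f - g) (f + g).
  apply: C0_ext => x; rewrite C0_mulE !C0_addE !C0_oppE !C0_mulE; ring.
by rewrite (le_trans (T_normM _ _))// TB TD ler_wpM2l// ler_normD.
Qed.

Let sqrt_iter_cauchy f n : `|T f| <= 3 / 4 ->
  `|T (sqrt_iter f n.+1) - T (sqrt_iter f n)| <= 1 / 2 ^+ n.
Proof.
move=> Tf; elim: n => [|n IH].
  rewrite expr0 divr1 [T (sqrt_iter f 0)]T0 subr0.
  rewrite (le_trans (sqrt_iter_le _ 1 Tf))// invf_le1//.
  by rewrite ler1n.
rewrite (sqrt_iterS f n.+1) [in X in _ - X]sqrt_iterS !Thalf -scalerBr normrZ.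
rewrite ger0_norm ?invr_ge0//.
rewrite -TB opprD addrACA subrr add0r exprS invfM mulrCA ler_pM2l ?invr_gt0//.
rewrite (le_trans (sqr_sub_le _ _))// -[leRHS]mulr1 ler_pM ?addr_ge0//.
have := sqrt_iter_le _ n Tf; have := sqrt_iter_le _ n.+1 Tf. lra.
Qed.

(** The images under T of the iterates converge in C_0(Y), and the preimage g of
    their limit satisfies (1 - g)^2 = 1 - f. *)
Let le1_of_small f x : `|T f| <= 3 / 4 -> f x <= 1.
Proof.
move=> Tf; pose v := sqrt_iter f.
have [l lv] :=
  C0_complete (fun n => T (v n)) 1 (fun n => sqrt_iter_cauchy f n Tf).
pose g := S l.
have l2 : `|l| <= 2 by have := lv 0; rewrite expr0 divr1 T0 subr0 mulr1.
pose w := f + C0_mul g g - 2%:R *: g.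
have wE n : w = 2%:R *: (v n.+1 - g) + (C0_mul g g - C0_mul (v n) (v n)).
  apply: C0_ext => z; rewrite /w /v sqrt_iterS.
  by rewrite !(C0_addE,C0_oppE,C0_scaleE,C0_mulE); field.
have Tw n : `|T w| <= 7 / 2 ^+ n.
  rewrite (wE n) TD TZn (le_trans (ler_normD _ _))//.
  have -> : 7 / 2 ^+ n = 2 / 2 ^+ n + 2 * 1 / 2 ^+ n * (5 / 2) :> R by lra.
  apply: lerD.
    rewrite normrZ normr_nat TB SK distrC.
    have -> : 2 / 2 ^+ n = 2 * (2 * 1 / 2 ^+ n.+1) :> R.
      by rewrite exprS invfM; lra.
    by rewrite ler_pM2l ?ltr0n// lv.
  rewrite (le_trans (sqr_sub_le _ _))// /g SK ler_pM ?addr_ge0 ?lv//.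
  by have := sqrt_iter_le _ n Tf; rewrite -/(v n); lra.
have w0 : w = 0.
  rewrite -[w]TK; suff -> : T w = 0 by rewrite -T0 TK.
  apply/eqP; rewrite -normr_le0 leNgt; apply/negP => Tw0.
  have := Tw (Num.bound (7 / `|T w|)); apply/negP; rewrite -ltNge.
  rewrite ltr_pdivrMr ?exprn_gt0// [ltRHS]mulrC -ltr_pdivrMr//.
  exact: upper_nthrootP.
have := congr1 (fun h : C0 R X => h x) w0.
rewrite /w !(C0_addE,C0_oppE,C0_scaleE,C0_mulE) C0_eval0.
by have := sqr_ge0 (1 - g x); nra.
Qed.

(** At this stage T is homogeneous for rational scalars only, so f is divided by
    a fraction lying strictly between 2 |T f| and f x. *)
Let eval_le f x : f x <= 2 * `|T f|.
Proof.
rewrite leNgt; apply/negP => fx; set m := `|T f| in fx.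
have m0 : 0 <= m by rewrite normr_ge0.
pose n := Num.bound (f x - 2 * m)^-1.
have nf : 1 < n%:R * (f x - 2 * m).
  rewrite -ltr_pdivrMr ?subr_gt0// mul1r archi_boundP//.
  by rewrite invr_ge0 subr_ge0 ltW.
pose k := Num.trunc (2 * m * n%:R).
have k1 : 2 * m * n%:R < k.+1%:R by exact: truncnS_gt.
have k2 : k%:R <= 2 * m * n%:R by rewrite truncn_le !mulr_ge0.
have k0 : 0 < k.+1%:R :> R by rewrite ltr0n.
have := le1_of_small ((n%:R / k.+1%:R) *: f) x.
rewrite TZq normrZ ger0_norm ?divr_ge0// -/m => H.
have {H} : (n%:R / k.+1%:R * f x <= 1).
  apply: H; rewrite mulrAC ler_pdivrMr//; lra.
rewrite mulrAC ler_pdivrMr// mul1r -natr1; lra.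
Qed.

Lemma norm_le_double_image f : `|f| <= 2 * `|T f|.
Proof.
apply: C0_norm_leP => [|x]; first by rewrite mulr_ge0.
rewrite ler_norml eval_le andbT lerNl -C0_oppE.
by rewrite -[`|T f|]normrN -TN eval_le.
Qed.

Let SD p q : S (p + q) = S p + S q.
Proof. by rewrite -{1}[p]SK -{1}[q]SK -TD TK. Qed.

Let S_bound p : `|S p| <= 2 * `|p|.
Proof. by rewrite -{2}[p]SK norm_le_double_image. Qed.

Let S0 : S 0 = 0.
Proof. by rewrite -T0 TK. Qed.

Let S_disj p q : C0_mul p q = 0 -> C0_mul (S p) (S q) = 0.
Proof.
move=> fg; rewrite -[LHS]TK (_ : T _ = 0) ?S0//.
by apply/eqP; rewrite -normr_eq0 TM !SK fg normr0.
Qed.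

Let T_disj f g : C0_mul f g = 0 -> C0_mul (T f) (T g) = 0.
Proof. by move=> fg; apply/eqP; rewrite -normr_eq0 -TM fg T0 normr0. Qed.

Context (X_nz : forall x, exists f : C0 R X, f x != 0).
Context (Y_nz : forall y, exists f : C0 R Y, f y != 0).

(** S, unlike T, is already known to be bounded at this point. *)
Lemma inverse_weighted_composition : exists (c : X -> R) (psi : X -> Y),
    (forall x, c x != 0) /\ forall p x, S p x = c x * p (psi x).
Proof.
apply: weighted_composition SD S_bound S_disj _ => x.
by have [f fx] := X_nz x; exists (T f); rewrite TK.
Qed.

(** At the points psi x the inequality holds pointwise, because there T (f g) is
    f x times T g.  It extends to all of Y since S only sees the values on the
    range of psi and is injective. *)
Let T_norm_mul_le f g : `|T (C0_mul f g)| <= `|f| * `|T g|.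
Proof.
have [c [psi [c0 SE]]] := inverse_weighted_composition.
have [h hE] := excess (T (C0_mul f g)) (T g) (`|f|) (normr_ge0 _).
have hpsi x : h (psi x) = 0.
  have Hx : T (C0_mul f g) (psi x) = f x * T g (psi x).
    apply: (mulfI (c0 x)); rewrite mulrCA -!SE !TK C0_mulE//.
  rewrite hE Hx normrM (max_idPl _)// subr_le0 ler_wpM2r// C0_norm_ge//.
have h0 : h = 0.
  rewrite -[h]SK -T0; congr T; apply: C0_ext => x.
  by rewrite SE hpsi mulr0 C0_eval0.
apply: C0_norm_leP => [|y]; first by rewrite mulr_ge0.
have := congr1 (fun k : C0 R Y => k y) h0; rewrite hE C0_eval0 => /eqP.
rewrite eq_maxl subr_le0 => /le_trans; apply.
by rewrite ler_wpM2l// C0_norm_ge.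
Qed.

Let sq k (f : C0 R X) := iter k (fun g => C0_mul g g) f.

Let norm_sq k f : `|sq k f| = `|f| ^+ (2 ^ k).
Proof.
elim: k => [|k IH]; first by rewrite expr1.
by rewrite /sq iterS C0_norm_sqr -/(sq k f) IH -exprM -expnSr.
Qed.

Let norm_T_sq k f : `|T (sq k f)| = `|T f| ^+ (2 ^ k).
Proof.
elim: k => [|k IH]; first by rewrite expr1.
by rewrite /sq iterS T_norm_sqr -/(sq k f) IH -exprM -expnSr.
Qed.

Lemma norm_le_image f : `|f| <= `|T f|.
Proof.
apply: (@le_of_power_bounds _ 1 2) => // k.
by rewrite mul1r -norm_sq -norm_T_sq norm_le_double_image.
Qed.

(** By [T_norm_mul_le], the 2^k-th power of f has an image of norm at most
    |f|^(2^k - 1) |T f|, and this norm is |T f|^(2^k). *)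
Lemma image_norm_le f : `|T f| <= `|f|.
Proof.
have [->|f0] := eqVneq f 0; first by rewrite T0 !normr0.
apply: (@le_of_power_bounds _ (`|f|) (`|T f|)) => //.
  by rewrite normr_gt0.
move=> k; rewrite -norm_T_sq; elim: k => [|k IH]; first by rewrite mulrC.
rewrite {1}/sq iterS -/(sq k f).
apply: (le_trans (ler_wpM2l (normr_ge0 _) (T_norm_mul_le _ _))).
have -> : `|T f| * `|f| ^+ (2 ^ k.+1) = `|sq k f| * (`|T f| * `|f| ^+ (2 ^ k)).
  by rewrite norm_sq expnS mul2n -addnn exprD mulrCA.
by rewrite mulrCA ler_wpM2l.
Qed.

Lemma forward_weighted_composition : exists (w : Y -> R) (phi : Y -> X),
    (forall y, w y != 0) /\ forall f y, T f y = w y * f (phi y).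
Proof.
have T1 f : `|T f| <= 1 * `|f| by rewrite mul1r image_norm_le.
apply: weighted_composition TD T1 T_disj _ => y.
by have [f fy] := Y_nz y; exists (S f); rewrite SK.
Qed.

End RingIsoInNorm.

(** * Continuity and invertibility of the weights and point maps *)

(** The set where T f is nonzero is open, and phi sends it into U as soon as f
    vanishes off U. *)
Lemma weighted_composition_continuous {R : realType} {X Y : topologicalType}
    {T : C0 R X -> C0 R Y} {w : Y -> R} {phi : Y -> X} :
  hausdorff_space X -> locally_compact [set: X] -> (forall y, w y != 0) ->
  (forall f y, T f y = w y * f (phi y)) -> continuous phi.
Proof.
move=> hX lX w0 TE y U Uy.
have [f [fy _ fU]] := C0_urysohn (R := R) hX lX Uy.
have Tfy : `|T f y| > 0 by rewrite normr_gt0 TE fy mulr1.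
have /cvgr_gt/(_ _ Tfy) : `|T f z| @[z --> y] --> `|T f y|.
  by apply: cvg_norm; exact: C0_continuous.
apply: filterS => z Tfz; apply: contrapT => /fU fz.
by move: Tfz; rewrite TE fz mulr0 normr0 ltxx.
Qed.

(** Near y, the sign of w is that of T f for a nonnegative f that is positive at
    phi y; so w is locally constant. *)
Lemma weighted_composition_sign_continuous {R : realType}
    {X Y : topologicalType}
    {T : C0 R X -> C0 R Y} {w : Y -> R} {phi : Y -> X} :
  hausdorff_space X -> locally_compact [set: X] -> sign_valued w ->
  (forall f y, T f y = w y * f (phi y)) -> continuous w.
Proof.
move=> hX lX w1 TE y U wU.
have [f [fy f01 _]] := C0_urysohn (R := R) hX lX (filterT : nbhs (phi y) setT).
have wfy : 0 < w y * T f y.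
  by rewrite TE fy mulr1 -expr2; case: (w1 y) => ->; lra.
have /cvgr_gt/(_ _ wfy) : w y * T f z @[z --> y] --> w y * T f y.
  by apply: cvgM; [exact: cvg_cst | exact: C0_continuous].
apply: filterS => z; rewrite TE mulrA => wz.
suff wzE : w z = w y by rewrite /= wzE; exact: nbhs_singleton wU.
have := andP (f01 (phi z)).
by case: (w1 y) (w1 z) wz => -> [] -> //;
  rewrite ?(mulrN1,mulN1r,mulr1,opprK); lra.
Qed.

(** Evaluating S (T f) = f at x gives f x = c x w(psi x) f(phi (psi x)); a
    function separating x from phi (psi x) would contradict this. *)
Lemma cancel_of_weighted_compositions {R : realType} {X Y : topologicalType}
    {T : C0 R X -> C0 R Y} {S : C0 R Y -> C0 R X}
    {w : Y -> R} {phi : Y -> X} {c : X -> R} {psi : X -> Y} :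
  hausdorff_space X -> locally_compact [set: X] -> cancel T S ->
  (forall f y, T f y = w y * f (phi y)) ->
  (forall p x, S p x = c x * p (psi x)) ->
  cancel psi phi /\ forall x, c x * w (psi x) = 1.
Proof.
move=> hX lX TK TE SE.
have E (f : C0 R X) x : f x = c x * w (psi x) * f (phi (psi x)).
  by rewrite -{1}(TK f) SE TE mulrA.
have psiK : cancel psi phi.
  move=> x; apply: contrapT => /eqP; rewrite eq_sym => nx.
  have [U [oU /set_mem Ux /set_mem nU]] := hausdorff_accessible hX nx.
  have [f [fx _ fU]] := C0_urysohn (R := R) hX lX (open_nbhs_nbhs (conj oU Ux)).
  by have := E f x; rewrite fx fU// mulr0 => /eqP; rewrite oner_eq0.
split=> // x.
have [f [fx _ _]] := C0_urysohn (R := R) hX lX (filterT : nbhs x setT).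
by have := E f x; rewrite psiK fx mulr1.
Qed.

Lemma weight_le1 {R : realType} {X Y : topologicalType}
    {T : C0 R X -> C0 R Y} {w : Y -> R} {phi : Y -> X} :
  hausdorff_space X -> locally_compact [set: X] ->
  (forall f, `|T f| <= `|f|) ->
  (forall f y, T f y = w y * f (phi y)) -> forall y, `|w y| <= 1.
Proof.
move=> hX lX T1 TE y.
have [f [fy f01 _]] := C0_urysohn (R := R) hX lX (filterT : nbhs (phi y) setT).
have <- : T f y = w y by rewrite TE fy mulr1.
rewrite (le_trans (C0_norm_ge _ _))// (le_trans (T1 f))//.
by apply: C0_norm_leP => // z; rewrite ger0_norm; have /andP[] := f01 z.
Qed.

(** * From ring isomorphisms in norm to weighted compositions *)

(** Since T and S are contractions, both factors of c (phi y) * w y = 1 have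
    absolute value at most 1; hence |w y| = 1. *)
Lemma ring_iso_in_norm_weighted_composition (R : realType)
    (X Y : topologicalType) (hX : hausdorff_space X) (hY : hausdorff_space Y)
    (lX : locally_compact [set: X]) (lY : locally_compact [set: Y])
    (T : C0 R X -> C0 R Y) : ring_iso_in_norm T ->
  exists (w : Y -> R) (phi : Y -> X),
    [/\ continuous w, sign_valued w, homeomorphism phi &
        forall (f : C0 R X) (y : Y), T f y = w y * f (phi y)].
Proof.
move=> [[S TK SK] TDn TM].
have TD := norm_additive_is_additive _ _ _ _ _ TK SK TDn.
have nz (Z : topologicalType) : hausdorff_space Z -> locally_compact [set: Z] ->
    forall z, exists f : C0 R Z, f z != 0.
  move=> hZ lZ z.
  have [f [fz _ _]] := C0_urysohn (R := R) hZ lZ (filterT : nbhs z setT).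
  by exists f; rewrite fz oner_eq0.
have Xnz := nz _ hX lX; have Ynz := nz _ hY lY.
have [c [psi [c0 SE]]] := inverse_weighted_composition T S TK SK TD TM Xnz.
have [w [phi [w0 TE]]] := forward_weighted_composition T S TK SK TD TM Xnz Ynz.
have [psiK cw] := cancel_of_weighted_compositions hX lX TK TE SE.
have [phiK _] := cancel_of_weighted_compositions hY lY SK SE TE.
have w_le1 := weight_le1 hX lX (image_norm_le T S TK SK TD TM Xnz) TE.
have c_le1 : forall x, `|c x| <= 1.
  apply: weight_le1 hY lY _ SE => p.
  by rewrite -{2}[p]SK; exact: (norm_le_image T S TK SK TD TM).
have wS : sign_valued w.
  move=> y; have := cw (phi y); rewrite phiK => cw1.
  have w1 : `|w y| = 1.
    apply/eqP; rewrite eq_le w_le1/=.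
    rewrite -[leLHS]normr1 -cw1 normrM ler_piMl//.
  move: w1 => /eqP; rewrite eqr_norml ler01 andbT.
  by move=> /orP[]/eqP; [left|right].
exists w, phi; split=> //.
  exact: weighted_composition_sign_continuous hX lX wS TE.
split; first exact: weighted_composition_continuous hX lX w0 TE.
exists psi; split=> //.
exact: weighted_composition_continuous hY lY c0 SE.
Qed.

(** * Weighted compositions by homeomorphisms and signs *)

Lemma C0_pred_weighted_composition {R : realType} {X Y : topologicalType}
    (w : Y -> R) (phi : Y -> X) (f : C0 R X) :
  continuous w -> sign_valued w -> homeomorphism phi ->
  (fun y => w y * f (phi y)) \in @C0_pred R Y.
Proof.
move=> cw w1 [cphi [psi [phiK psiK cpsi]]]; apply/C0P; split.
  move=> y; apply: cvgM; first exact: cw.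
  by apply: continuous_comp; [exact: cphi | exact: C0_continuous].
move=> e e0; have [K cK fK] := C0_vanishes f e0.
exists (psi @` K).
  by apply: continuous_compact cK; exact: continuous_subspaceT.
move=> y nK; rewrite normrM (_ : `|w y| = 1) ?mul1r.
  by apply: fK => Ky; apply: nK; exists (phi y).
by case: (w1 y) => ->; rewrite ?normrN normr1.
Qed.

(** The inverse of T is the weighted composition with w o psi and psi, where psi
    is the inverse of phi.  T is additive, and T (f g) differs from T f * T g
    only by the sign w. *)
Lemma weighted_composition_ring_iso_in_norm {R : realType}
    {X Y : topologicalType} (w : Y -> R) (phi : Y -> X)
    (T : C0 R X -> C0 R Y) :
  continuous w -> sign_valued w -> homeomorphism phi ->
  (forall f y, T f y = w y * f (phi y)) -> ring_iso_in_norm T.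
Proof.
move=> cw w1 hphi TE; have w2 y : w y * w y = 1.
  by case: (w1 y) => ->; rewrite ?mulrNN mulr1.
have wn y : `|w y| = 1 by case: (w1 y) => ->; rewrite ?normrN normr1.
have [cphi [psi [phiK psiK cpsi]]] := hphi.
have cwpsi : continuous (w \o psi).
  by move=> x; apply: continuous_comp; [exact: cpsi | exact: cw].
have hpsi : homeomorphism psi by split=> //; exists phi; split.
split.
- exists (fun p => MkC0 (C0_pred_weighted_composition (w \o psi) psi p cwpsi
                           (fun x => w1 (psi x)) hpsi)).
    by move=> f; apply: C0_ext => x /=; rewrite TE psiK mulrA w2 mul1r.
  by move=> p; apply: C0_ext => y /=; rewrite TE /= phiK mulrA w2 mul1r.
- move=> f g; congr (`|_|); apply: C0_ext => y.
  by rewrite C0_addE !TE C0_addE mulrDr.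
- move=> f g; apply: C0_norm_eq => y; exists y;
    by rewrite C0_mulE !TE C0_mulE !normrM !wn !mul1r.
Qed.

Theorem theorem1p2 (R : realType) (X Y : topologicalType)
    (X_nonempty : [set: X] !=set0) (Y_nonempty : [set: Y] !=set0)
    (X_hausdorff : hausdorff_space X) (Y_hausdorff : hausdorff_space Y)
    (X_locally_compact : locally_compact [set: X])
    (Y_locally_compact : locally_compact [set: Y]) :
  (forall T : C0 R X -> C0 R Y, ring_iso_in_norm T ->
    exists (w : Y -> R) (phi : Y -> X),
      [/\ continuous w, sign_valued w, homeomorphism phi &
          forall (f : C0 R X) (y : Y), T f y = w y * f (phi y)]) /\
  (forall (w : Y -> R) (phi : Y -> X),
    continuous w -> sign_valued w -> homeomorphism phi ->
    (exists T : C0 R X -> C0 R Y,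
      forall (f : C0 R X) (y : Y), T f y = w y * f (phi y)) /\
    (forall T : C0 R X -> C0 R Y,
      (forall (f : C0 R X) (y : Y), T f y = w y * f (phi y)) ->
      ring_iso_in_norm T)).
Proof.
split=> [T|w phi cw w1 hphi].
  exact: ring_iso_in_norm_weighted_composition.
split; last by move=> T; exact: weighted_composition_ring_iso_in_norm.
by exists (fun f => MkC0 (C0_pred_weighted_composition w phi f cw w1 hphi)).
Qed.
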